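(* Let $D\ge1$ be an integer and $B>0$. Let $\beta\in\mathbb{R}^{D+1}$ be the identity vector, indexed by $\{0,1,\dots,D\}$ with $\beta_p=p$. For a vector $\alpha\in\mathbb{R}^{D+1}$ (indexed by $\{0,\dots,D\}$) let $M$ be the $(D+1)\times(D+1)$ counting matrix associated with the Gaussian kernel $f(x)=e^{-Bx}$ and $\alpha,\beta$, i.e. $M[\ell,p]=f(c+\alpha_\ell\beta_p)$ with $c+\alpha_\ell\beta_p\in[0,1]$ for all $\ell,p$. Then there exists a vector $\alpha$ such that $M$ is invertible and $$\tau(M)\le\left(\frac{5e}{1-e^{-B/D}}\right)^D,$$ where $\tau(M)=\max_{0\ne b}\|M^{-1}b\|_\infty/\|b\|_\infty$.
   Context: The counting matrix of a function $f:[0,1]\to\mathbb{R}$, vectors $\alpha,\beta$ and a real number $c$ with $c+\alpha_\ell\beta_p\in[0,1]$ for all indices is the matrix $M[\ell,p]=f(c+\alpha_\ell\beta_p)$. *)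

(* Defs.v *)
From HB Require Import structures.
From mathcomp Require Export all_boot all_order all_algebra.
From mathcomp Require Export all_classical all_reals all_analysis.

Set Implicit Arguments.
Unset Strict Implicit.
Unset Printing Implicit Defensive.

Import Order.TTheory GRing.Theory Num.Theory.
Import numFieldNormedType.Exports.

Local Open Scope classical_set_scope.
Local Open Scope ring_scope.

Definition counting_args (R : realType) (m n : nat)
    (c : R) (alpha : 'rV[R]_m) (beta : 'rV[R]_n) : Prop :=
  forall l p, 0 <= c + alpha 0 l * beta 0 p <= 1.

(* A function on [0,1] is a total f : R -> R; only its values on [0,1] enter
   when counting_args c alpha beta holds. *)
Definition counting_matrix (R : realType) (m n : nat) (f : R -> R)
    (c : R) (alpha : 'rV[R]_m) (beta : 'rV[R]_n) : 'M[R]_(m, n) :=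
  \matrix_(l < m, p < n) f (c + alpha 0 l * beta 0 p).

Definition identity_vector (R : realType) (n : nat) : 'rV[R]_n :=
  \row_(p < n) p%:R.

Definition gaussian_kernel (R : realType) (B x : R) : R := expR (- B * x).

(* `| b | on matrices is mx_norm, the largest absolute value of an entry, i.e.
   the infinity norm of a column vector. *)
Definition tau_ratios (R : realType) (n : nat) (M : 'M[R]_n) : set R :=
  [set `|invmx M *m b| / `|b| | b in [set b : 'cV[R]_n | b != 0]].

(* This supremum is a maximum, see tau_max. *)
Definition tau (R : realType) (n : nat) (M : 'M[R]_n) : R :=
  sup (tau_ratios M).

Lemma tau_max (R : realType) (n : nat) (M : 'M[R]_n.+1) :
  tau_ratios M (tau M) /\ ubound (tau_ratios M) (tau M).
Proof.
set A := invmx M.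
pose S (i : 'I_n.+1) := \sum_j `|A i j|.
have [i0 _ hi0] : extremum_spec (fun x y : R => y <= x) predT S
    [arg max_(i > ord0) S i]%O by exact: arg_maxP.
have le_entry (b : 'cV[R]_n.+1) i : `|b i 0| <= `|b|.
  rewrite [leRHS]/Num.Def.normr /= mx_normrE.
  by apply/bigmax_geP; right => /=; exists (i, 0).
have norm_le (b : 'cV[R]_n.+1) (t : R) : 0 <= t ->
    (forall i, `|b i 0| <= t) -> `|b| <= t.
  move=> t0 h; rewrite [leLHS]/Num.Def.normr /= mx_normrE.
  by apply: bigmax_le => // -[i j] _ /=; rewrite (ord1 j).
have ubS : ubound (tau_ratios M) (S i0).
  move=> _ [b /= b0 <-]; rewrite ler_pdivrMr ?normr_gt0//.
  apply: norm_le => [|i].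
    by rewrite mulr_ge0 //; apply: sumr_ge0.
  rewrite mxE; apply: (le_trans (ler_norm_sum _ _ _)).
  apply: (@le_trans _ _ (S i * `|b|)); last by rewrite ler_wpM2r // hi0.
  rewrite mulr_suml; apply: ler_sum => j _.
  by rewrite normrM ler_wpM2l.
have inS : tau_ratios M (S i0).
  pose b : 'cV[R]_n.+1 := \col_j (if A i0 j < 0 then -1 else 1).
  have bE i : `|b i 0| = 1 by rewrite mxE; case: ifP; rewrite ?normrN1 ?normr1.
  have nb : `|b| = 1.
    apply/eqP; rewrite eq_le norm_le //= ?ler01// => [|i]; last by rewrite bE.
    by rewrite -(bE 0) le_entry.
  have b0 : b != 0 by rewrite -normr_gt0 nb ltr01.
  have mem : tau_ratios M (`|A *m b| / `|b|) by exists b.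
  suff -> : S i0 = `|A *m b| / `|b| by [].
  apply/eqP; rewrite eq_le (ubS _ mem) andbT nb divr1.
  apply: le_trans (le_entry (A *m b) i0).
  rewrite mxE; apply: le_trans (ler_norm _).
  apply: ler_sum => j _; rewrite mxE; case: ltP => hA.
    by rewrite ltr0_norm // mulrN1.
  by rewrite ger0_norm // mulr1.
suff -> : tau M = S i0 by [].
apply/eqP; rewrite eq_le /tau ge_sup //=; last by exists (S i0).
by apply: ub_le_sup => //; exists (S i0).
Qed.

(* Main.v *)
Require Import Defs.
From mathcomp Require Import all_boot all_order all_algebra.
From mathcomp Require Import all_classical all_reals all_analysis.
From mathcomp Require Import ring.

Set Implicit Arguments.
Unset Strict Implicit.
Unset Printing Implicit Defensive.

Import Order.TTheory GRing.Theory Num.Theory.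
Import numFieldNormedType.Exports.
Local Open Scope ring_scope.

(** Take [c = 0] and choose [alpha] so that the nodes
    [x_l = exp (- B alpha_l) = 1 - delta l / D], [delta = 1 - exp (- B / D)],
    are equally spaced in [[exp (- B / D), 1]]. Then [M] is the Vandermonde
    matrix [x_l ^ p], and its inverse consists of the coefficients of the
    Lagrange polynomials [L_l]. Since [|x_k| <= 1], the numerator of [L_l] has
    coefficients at most ['C(D, p) <= 2 ^ D] in absolute value, while its
    denominator is [(delta / D) ^ D l! (D - l)!] up to sign. Summing over [l]
    gives [tau M <= 2 ^ D (D / delta) ^ D 2 ^ D / D! <= (4 e / delta) ^ D],
    because [D ^ D <= e ^ D D!]. *)

(** Coefficientwise, each factor is dominated by ['X + 1], whose powers have binomial coefficients;
    the inductive step is Pascal's rule. *)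
Lemma normr_coef_prod_XsubC_le (R : numDomainType) (I : Type) (s : seq I)
    (x : I -> R) (i : nat) : (forall k, `|x k| <= 1) ->
  `|(\prod_(k <- s) ('X - (x k)%:P))`_i| <= 'C(size s, i)%:R.
Proof.
move=> x1; elim: s i => [|k s IHs] i.
  by rewrite big_nil coef1; case: i => [|i]; rewrite ?normr1 ?normr0.
rewrite big_cons mulrBl coefB coefXM coefCM /=.
have le_xk j (q : {poly R}) : `|q`_j| <= 'C(size s, j)%:R ->
    `|x k * q`_j| <= 'C(size s, j)%:R.
  by move=> hq; rewrite normrM -[leRHS]mul1r ler_pM.
case: i => [|i] /=.
  by rewrite sub0r normrN bin0 -(bin0 (size s)) le_xk.
rewrite binS natrD [leRHS]addrC.
by apply: (le_trans (ler_normB _ _)); rewrite lerD ?le_xk.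
Qed.

(** The indices below [l] contribute [l!], those above it [m!]. Writing the range as [l + m] lets
    induction on [m] add one factor, [m + 1], at a time. *)
Lemma prod_dist_ord (R : realDomainType) (l m : nat) :
  \prod_(k < (l + m).+1 | (k : nat) != l) `|l%:R - k%:R : R| =
  (l`! * m`!)%:R.
Proof.
elim: m => [|m IHm].
  rewrite addn0 muln1 big_mkcond big_ord_recr /= eqxx mulr1.
  rewrite -ffactnn ffact_prod natr_prod; apply: eq_bigr => k _.
  by rewrite neq_ltn ltn_ord -natrB ?ger0_norm ?ler0n // ltnW.
rewrite big_mkcond addnS big_ord_recr -big_mkcond /= IHm.
rewrite gtn_eqF ?ltnS ?leq_addr //= -addnS.
by rewrite natrD opprD addNKr normrN normr_nat factS -natrM; congr _%:R; ring.
Qed.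

Lemma expn_le_expR_fact (R : realType) (n : nat) :
  n%:R ^+ n <= expR 1 ^+ n * n`!%:R :> R.
Proof.
elim: n => [|n IHn]; first by rewrite !expr0 mulr1.
(* For positive [n] this is [(1 + 1/n)^n <= e], which follows from [1 + y <= exp y] at [y = 1/n]. *)
suff h : (n.+1%:R : R) ^+ n <= expR 1 * n%:R ^+ n.
  rewrite exprS factS natrM mulrCA ler_pM2l ?ltr0n // exprS -mulrA.
  by apply: (le_trans h); rewrite ler_pM2l ?expR_gt0.
case: n {IHn} => [|n]; first by rewrite !expr0 mulr1 -[leLHS]expR0 ler_expR.
have n0 : (0 : R) < n.+1%:R by rewrite ltr0n.
have -> : (n.+2%:R : R) = n.+1%:R * (1 + n.+1%:R^-1).
  by rewrite mulrDr mulr1 divff ?gt_eqF // natr1.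
rewrite exprMn mulrC ler_wpM2r ?exprn_ge0 ?ler0n //.
have -> : expR 1 = expR (n.+1%:R^-1) ^+ n.+1 :> R.
  by rewrite -expRM_natl mulrC mulVf // gt_eqF.
by rewrite lerXn2r ?nnegrE ?expR_ge0 ?expR_ge1Dx // addr_ge0 // invr_ge0 ltW.
Qed.

Section LagrangeBasis.
Variables (F : fieldType) (n : nat) (x : 'I_n -> F).

Definition lagrange_basis (l : 'I_n) : {poly F} :=
  (\prod_(k | k != l) (x l - x k))^-1 *: \prod_(k | k != l) ('X - (x k)%:P).

Lemma size_lagrange_basis l : (size (lagrange_basis l) <= n)%N.
Proof.
apply: leq_trans (size_scale_leq _ _) _.
rewrite -big_enum size_prod_XsubC -cardE cardC1 card_ord prednK //.
by case: n l => // -[].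
Qed.

Lemma horner_lagrange_basis k l : injective x ->
  (lagrange_basis l).[x k] = (k == l)%:R.
Proof.
move=> x_inj; rewrite hornerZ horner_prod.
under [X in _ * X]eq_bigr do rewrite !hornerE.
case: (eqVneq k l) => [->|kl]; last first.
  by rewrite [X in _ * X](bigD1 k) //= subrr mul0r mulr0.
rewrite mulVf //; apply/prodf_neq0 => j jl.
by rewrite subr_eq0 (inj_eq x_inj) eq_sym.
Qed.

(** Entry [(k, l)] of the product is the value at [x k] of the [l]-th basis polynomial, whose degree
    is below [n], so its first [n] coefficients suffice. *)
Lemma mul_vandermonde_lagrange_basis : injective x ->
  (\matrix_(l < n, p < n) x l ^+ p) *m
  (\matrix_(p < n, l < n) (lagrange_basis l)`_p) = 1%:M.
Proof.
move=> x_inj; apply/matrixP => k l; rewrite !mxE.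
rewrite -horner_lagrange_basis // (horner_coef_wide _ (size_lagrange_basis l)).
by apply: eq_bigr => p _; rewrite !mxE mulrC.
Qed.

End LagrangeBasis.

(** A right inverse of a square matrix is its inverse. Since [tau] is attained at some [b], it is
    enough to bound that single ratio by the absolute row sums. *)
Lemma tau_right_inverse_le (R : realType) (n : nat) (M A : 'M[R]_n.+1) (t : R) :
  M *m A = 1%:M -> (forall i, \sum_j `|A i j| <= t) -> tau M <= t.
Proof.
move=> MA At; have [uM _] := mulmx1_unit MA.
have [[b /= b0 <-] _] := tau_max M.
have -> : invmx M = A by rewrite -[RHS](mulKmx uM) MA mulmx1.
have t0 : 0 <= t by apply: le_trans (At 0); exact: sumr_ge0.
rewrite ler_pdivrMr ?normr_gt0 // [leLHS]/Num.Def.normr /= mx_normrE.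
apply: bigmax_le => [|[i j] _ /=]; first by rewrite mulr_ge0.
rewrite mxE; apply: (le_trans (ler_norm_sum _ _ _)).
apply: (le_trans _ (ler_wpM2r (normr_ge0 b) (At i))).
rewrite mulr_suml; apply: ler_sum => k _; rewrite normrM ler_wpM2l //.
rewrite [leRHS]/Num.Def.normr /= mx_normrE.
by apply/bigmax_geP; right => /=; exists (k, j).
Qed.

Section EquispacedNodes.
Variables (R : realType) (D : nat) (d : R).
Hypotheses (D_gt0 : (0 < D)%N) (d_gt0 : 0 < d) (d_le1 : d <= 1).

Definition equispaced_node (l : 'I_D.+1) : R := 1 - d * (l%:R / D%:R).

Lemma equispaced_node_itv l : 1 - d <= equispaced_node l <= 1.
Proof.
have D0 : (0 : R) < D%:R by rewrite ltr0n.
rewrite /equispaced_node lerD2l lerN2 gerBl mulr_ge0 ?divr_ge0 ?(ltW d_gt0) //.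
rewrite andbT -[leRHS]mulr1 ler_pM2l // ler_pdivrMr // mul1r ler_nat.
by rewrite -ltnS.
Qed.

Lemma equispaced_nodeB k l :
  equispaced_node k - equispaced_node l = d / D%:R * (l%:R - k%:R).
Proof. by rewrite /equispaced_node; ring. Qed.

Lemma equispaced_node_inj : injective equispaced_node.
Proof.
move=> k l /eqP; rewrite -subr_eq0 equispaced_nodeB !mulf_eq0 invr_eq0.
rewrite pnatr_eq0 gt_eqF // gtn_eqF //= subr_eq0 eqr_nat => /eqP lk.
exact/esym/ord_inj.
Qed.

Lemma norm_lagrange_denom l :
  `|\prod_(k | k != l) (equispaced_node l - equispaced_node k)| =
  (d / D%:R) ^+ D * (l`! * (D - l)`!)%:R.
Proof.
have lD : (l <= D)%N by rewrite -ltnS.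
rewrite normr_prod.
under eq_bigr => k _ do rewrite equispaced_nodeB normrM distrC.
rewrite big_split /= prodr_const cardC1 card_ord /=.
rewrite ger0_norm ?divr_ge0 ?(ltW d_gt0) //.
(* [prod_dist_ord] applies with [D = l + (D - l)]. *)
by congr (_ * _); rewrite -prod_dist_ord subnKC.
Qed.

(** With [p] fixed and [l] varying, this is an absolute row sum of the inverse Vandermonde
    matrix. *)
Lemma sum_norm_coef_lagrange_le (p : nat) :
  \sum_l `|(lagrange_basis equispaced_node l)`_p| <= (4 * expR 1 / d) ^+ D.
Proof.
have D0 : (0 : R) < D%:R by rewrite ltr0n.
have dD0 : 0 < (D%:R / d) ^+ D by rewrite exprn_gt0 // divr_gt0.
have f0 m : (0 : R) < m`!%:R by rewrite ltr0n fact_gt0.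
have node1 k : `|equispaced_node k| <= 1.
  have /andP[h1 h2] := equispaced_node_itv k.
  by rewrite ger0_norm // (le_trans _ h1) // subr_ge0.
have binX m k : 'C(m, k)%:R <= 2 ^+ m :> R.
  rewrite -natrX ler_nat; have [km|mk] := leqP k m; last by rewrite bin_small.
  rewrite -[2%N]/(1 + 1)%N expnDn (bigD1 (Ordinal (km : k < m.+1)%N)) //=.
  by rewrite !exp1n !muln1 leq_addr.
(* The factor [2 ^+ D] bounds the numerator coefficient, and [1 / (l! (D - l)!) = 'C(D, l) / D!]
   leaves binomials that sum to a second [2 ^ D]. *)
apply: (@le_trans _ _ (\sum_(l < D.+1)
    2 ^+ D * (D%:R / d) ^+ D / D`!%:R * 'C(D, l)%:R)).
  apply: ler_sum => l _; have lD : (l <= D)%N by rewrite -ltnS.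
  rewrite coefZ normrM normfV norm_lagrange_denom -(bin_fact lD) !natrM.
  rewrite -big_enum.
  have := @normr_coef_prod_XsubC_le R _ (enum (predC1 l)) equispaced_node p node1.
  rewrite -cardE cardC1 card_ord /= => /le_trans/(_ (binX _ _)) hc.
  have C0 : (0 : R) < 'C(D, l)%:R by rewrite ltr0n bin_gt0.
  have -> : 2 ^+ D * (D%:R / d) ^+ D / ('C(D, l)%:R * (l`!%:R * (D - l)`!%:R))
      * 'C(D, l)%:R
      = ((d / D%:R) ^+ D * (l`!%:R * (D - l)`!%:R))^-1 * 2 ^+ D :> R.
    rewrite -(invf_div D%:R d) exprVn; field.
    by rewrite !gt_eqF.
  rewrite ler_wpM2l // invr_ge0 !mulr_ge0 ?ler0n // exprn_ge0 // divr_ge0 //.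
  exact: ltW.
rewrite -mulr_sumr -natr_sum.
have -> : (\sum_(l < D.+1) 'C(D, l))%N = (2 ^ D)%N.
  rewrite -[2%N]/(1 + 1)%N expnDn; apply: eq_bigr => l _.
  by rewrite !exp1n !muln1.
have -> : (4 * expR 1 / d) ^+ D = 2 ^+ D * (2 ^+ D * (expR 1 ^+ D / d ^+ D)).
  by rewrite -expr_div_n -!exprMn; congr (_ ^+ _); ring.
rewrite natrX expr_div_n.
have -> : 2 ^+ D * (D%:R ^+ D / d ^+ D) / D`!%:R * 2 ^+ D =
    2 ^+ D * (2 ^+ D * (D%:R ^+ D / D`!%:R / d ^+ D)) :> R by ring.
have d0 : 0 < d ^+ D by rewrite exprn_gt0.
rewrite !ler_pM2l ?exprn_gt0 // ler_pM2r ?invr_gt0 // ler_pdivrMr //.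
exact: expn_le_expR_fact.
Qed.

End EquispacedNodes.

Theorem theorem12 (R : realType) (D : nat) (B : R) (hD : (1 <= D)%N)
    (hB : 0 < B) :
  exists (c : R) (alpha : 'rV[R]_D.+1),
    let beta := identity_vector R D.+1 in
    let M := counting_matrix (gaussian_kernel B) c alpha beta in
    [/\ counting_args c alpha beta,
        M \in unitmx &
        tau M <= (5 * expR 1 / (1 - expR (- (B / D%:R)))) ^+ D].
Proof.
have D0 : (0 : R) < D%:R by rewrite ltr0n.
set d := 1 - expR (- (B / D%:R)).
have d0 : 0 < d by rewrite subr_gt0 expR_lt1 oppr_lt0 divr_gt0.
have d1 : d <= 1 by rewrite gerBl expR_ge0.
pose x := @equispaced_node R D d.
have x_itv l : expR (- (B / D%:R)) <= x l <= 1.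
  by have := @equispaced_node_itv R D d hD d0 l; rewrite {1}/d subKr.
have x0 l : 0 < x l.
  by have /andP[+ _] := x_itv l; apply: lt_le_trans; exact: expR_gt0.
(* This [alpha] solves [exp (- B alpha_l) = x l]. *)
exists 0, (\row_l (- ln (x l) / B)) => beta M.
have ME : M = \matrix_(l < D.+1, p < D.+1) x l ^+ p.
  apply/matrixP => l p; rewrite !mxE /gaussian_kernel.
  have -> : - B * (0 + - ln (x l) / B * p%:R) = p%:R * ln (x l).
    by field; rewrite gt_eqF.
  by rewrite expRM_natl lnK // posrE.
have MA := mul_vandermonde_lagrange_basis (@equispaced_node_inj R D d hD d0).
rewrite -/x -ME in MA.
split; last 2 first.
- by have [] := mulmx1_unit MA.
(* The construction yields the constant 4, here relaxed to 5. *)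
- apply: (@le_trans _ _ ((4 * expR 1 / d) ^+ D)); last first.
    rewrite lerXn2r ?nnegrE ?divr_ge0 ?mulr_ge0 ?expR_ge0 ?(ltW d0) //.
    by rewrite ler_pM2r ?invr_gt0 // ler_pM2r ?expR_gt0 // ler_nat.
  apply: (tau_right_inverse_le MA) => p.
  under eq_bigr do rewrite mxE.
  exact: sum_norm_coef_lagrange_le.
move=> l p; rewrite !mxE add0r.
have /andP[xl xu] := x_itv l.
have nl0 : 0 <= - ln (x l) / B.
  by rewrite divr_ge0 ?(ltW hB) // oppr_ge0 ln_le0.
rewrite mulr_ge0 //=.
(* The lower end [exp (- B / D)] of the node interval gives [alpha_l <= 1 / D], hence
   [alpha_l p <= 1] for all [p <= D]. *)
have nl1 : - ln (x l) / B <= D%:R^-1.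
  by rewrite ler_pdivrMr // lerNl mulrC -ler_expR lnK ?posrE.
apply: (@le_trans _ _ (D%:R^-1 * D%:R)); last by rewrite mulVf ?gt_eqF.
by rewrite ler_pM ?ler0n // ler_nat -ltnS.
Qed.
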